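(* Let $d>1$, let $\boldsymbol{\mu}^{\pi},\boldsymbol{\mu}^{L},\boldsymbol{\lambda}\in\mathbb{R}^d$, and let $\Sigma^{\pi},\Sigma^{L}$ be $d\times d$ (nonsingular) covariance matrices. Suppose $\boldsymbol{\theta}\in\mathbb{R}^d$ has prior density $\phi(\boldsymbol{\theta};\boldsymbol{\mu}^{\pi},\Sigma^{\pi})$ and likelihood $L(\boldsymbol{\theta}\mid \text{data})\propto\phi(\boldsymbol{\theta};\boldsymbol{\mu}^{L},\Sigma^{L})$, and let the parameter of interest be $\eta=\boldsymbol{\lambda}^{\top}\boldsymbol{\theta}$. Put $\Sigma^{p}=\left[(\Sigma^{\pi})^{-1}+(\Sigma^{L})^{-1}\right]^{-1}$ and $$\Delta_1=\boldsymbol{\lambda}^{\top}\Sigma^{p}(\Sigma^{L})^{-1}(\boldsymbol{\mu}^{L}-\boldsymbol{\mu}^{\pi}),\qquad \Delta_2=\boldsymbol{\lambda}^{\top}\Sigma^{p}(\Sigma^{\pi})^{-1}(\boldsymbol{\mu}^{L}-\boldsymbol{\mu}^{\pi}).$$ Then the discrepant posterior phenomenon (DPP) for $\eta$ does not occur if and only if either $\Delta_1\ge 0$ and $\Delta_2\ge 0$, or $\Delta_1\le 0$ and $\Delta_2\le 0$.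
   Context: $\phi(\cdot;\boldsymbol{\mu},\Sigma)$ denotes the multivariate Gaussian density with mean $\boldsymbol{\mu}$ and covariance matrix $\Sigma$ (covariance matrices are symmetric positive definite). The posterior of $\boldsymbol{\theta}$ is the probability distribution with density proportional to the product of the prior density and the likelihood; here it is Gaussian, and $\boldsymbol{\mu}^{p}$ denotes its mean. Write $\eta^{p}=\boldsymbol{\lambda}^{\top}\boldsymbol{\mu}^{p}$ (posterior mean of $\eta$), $\eta^{\pi}=\boldsymbol{\lambda}^{\top}\boldsymbol{\mu}^{\pi}$ (prior mean of $\eta$), and $\eta^{L}=\boldsymbol{\lambda}^{\top}\boldsymbol{\mu}^{L}$ (maximum likelihood estimate of $\eta$). Definition: the discrepant posterior phenomenon (DPP) occurs if $(\eta^{p}-\eta^{\pi})(\eta^{p}-\eta^{L})>0$. *)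

(* Defs.v *)
From HB Require Import structures.
From mathcomp Require Import all_boot all_order all_algebra.
From mathcomp Require Import sesquilinear.
From mathcomp Require Import all_classical all_reals all_analysis.

Set Implicit Arguments.
Unset Strict Implicit.
Unset Printing Implicit Defensive.

Import Order.TTheory GRing.Theory Num.Theory.
Import numFieldNormedType.Exports.

Local Open Scope classical_set_scope.
Local Open Scope ring_scope.

(** MathComp-Analysis equips [n.-tuple R] with the product sigma-algebra but
    only has binary product measures, so the n-fold product of the
    one-dimensional Lebesgue measure is obtained by iterating them. *)

Section LebesgueTuple.
Context (R : realType).

Definition cons_pair n (p : R * n.-tuple R) : n.+1.-tuple R :=
  [tuple of p.1 :: p.2].

Lemma measurable_cons_pair n : measurable_fun [set: R * n.-tuple R] (@cons_pair n).
Proof. exact: measurable_cons. Qed.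

Section Step.
Context (n : nat) (m : {sigma_finite_measure set (n.-tuple R) -> \bar R}).

Definition lebesgue_cons : set (n.+1.-tuple R) -> \bar R :=
  pushforward (@lebesgue_measure R \x m)%E (@cons_pair n).

Let lebesgue_cons0 : lebesgue_cons set0 = 0%E.
Proof. by rewrite /lebesgue_cons /pushforward preimage_set0 measure0. Qed.

Let lebesgue_cons_ge0 A : (0 <= lebesgue_cons A)%E.
Proof. by rewrite /lebesgue_cons /pushforward; apply: measure_ge0. Qed.

Let lebesgue_cons_sigma_additive : semi_sigma_additive lebesgue_cons.
Proof.
move=> F mF tF mUF; rewrite /lebesgue_cons /pushforward preimage_bigcup.
apply: measure_semi_sigma_additive.
- by move=> k; rewrite -[X in measurable X]setTI; exact: measurable_cons_pair.
- apply/trivIsetP => /= i j _ _ ij; rewrite -preimage_setI.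
  by move/trivIsetP : tF => /(_ _ _ _ _ ij) ->//; rewrite preimage_set0.
- by rewrite -preimage_bigcup -[X in measurable X]setTI; exact: measurable_cons_pair.
Qed.

HB.instance Definition _ := isMeasure.Build _ _ _ lebesgue_cons
  lebesgue_cons0 lebesgue_cons_ge0 lebesgue_cons_sigma_additive.

Let lebesgue_cons_sigma_finite : sigma_finite setT lebesgue_cons.
Proof.
have /sigma_finiteP[F [FT ndF Foo]] := sigma_finiteT (@lebesgue_measure R).
have /sigma_finiteP[G [GT ndG Goo]] := sigma_finiteT m.
pose split_tuple (t : n.+1.-tuple R) : (measurableTypeR R * n.-tuple R)%type :=
  (thead t, [tuple of behead t]).
have split_tupleK : cancel (@cons_pair n) split_tuple.
  case=> x t; rewrite /split_tuple /cons_pair /= theadE; congr pair.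
  by apply: val_inj.
have msplit : measurable_fun setT split_tuple.
  by apply: measurable_fun_pair;
    [exact: measurable_tnth | exact: measurable_behead].
exists (fun k => split_tuple @^-1` (F k `*` G k)).
  apply/esym; rewrite -subTset => t _.
  have [i _ Fi] : (\bigcup_k F k) (thead t) by rewrite -FT.
  have [j _ Gj] : (\bigcup_k G k) [tuple of behead t] by rewrite -GT.
  exists (maxn i j) => //; split => /=.
  - by move: (thead t) Fi; exact/subsetPset/ndF/leq_maxl.
  - by move: [tuple of behead t] Gj; exact/subsetPset/ndG/leq_maxr.
move=> k; have [mF Fk] := Foo k; have [mG Gk] := Goo k; split.
  by rewrite -[X in measurable X]setTI; apply: msplit => //; exact: measurableX.
rewrite /lebesgue_cons /pushforward.
rewrite (_ : _ @^-1` _ = F k `*` G k); last first.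
  rewrite -comp_preimage (_ : split_tuple \o _ = id) ?preimage_id//.
  exact/funext/split_tupleK.
by rewrite product_measure1E// lte_mul_pinfty// ge0_fin_numE.
Qed.

HB.instance Definition _ := @Measure_isSigmaFinite.Build _ _ _ lebesgue_cons
  lebesgue_cons_sigma_finite.

End Step.

Fixpoint lebesgue_tuple (n : nat) :
    {sigma_finite_measure set (n.-tuple R) -> \bar R} :=
  match n with
  | 0 => \d_ [tuple]
  | n'.+1 => lebesgue_cons (lebesgue_tuple n')
  end.

Lemma lebesgue_tuple_box n (A : 'I_n -> set (measurableTypeR R)) :
  (forall i, measurable (A i)) ->
  lebesgue_tuple n [set t | forall i, A i (tnth t i)] =
  (\prod_(i < n) lebesgue_measure (A i))%E.
Proof.
elim: n => [|n IH] in A * => mA.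
  rewrite big_ord0 [LHS]diracE mem_set//= => -[].
  by case.
pose B : set (n.-tuple R) := [set t | forall i, A (lift ord0 i) (tnth t i)].
have mB : measurable B.
  rewrite (_ : B = \bigcap_(i : 'I_n) [set t | A (lift ord0 i) (tnth t i)]).
    apply: fin_bigcap_measurable => [|i _]; first exact: finite_finset.
    by rewrite -[X in measurable X]setTI; exact: (measurable_tnth i measurableT (mA (lift ord0 i))).
  by apply/seteqP; split => [t Bt i _|t Bt i]; exact: Bt.
rewrite big_ord_recl -IH; last by move=> i; exact: mA.
rewrite -product_measure1E//=; congr (product_measure1 _ _ _).
apply/seteqP; split => -[x t] /=.
- by move=> At; split; [have := At ord0|move=> i; have := At (lift ord0 i)];
    rewrite /cons_pair ?tnth0 ?tnthS.
- move=> [Ax Bt] i; case: (unliftP ord0 i) => [j ->|->].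
  + by rewrite /cons_pair tnthS.
  + by rewrite /cons_pair tnth0.
Qed.

End LebesgueTuple.

Section GaussianBayes.
Context (R : realType) (d : nat).
Implicit Types (u v mu theta : 'cV[R]_d) (Sigma : 'M[R]_d).
Implicit Types f g p prior lik : 'cV[R]_d -> R.

Definition dotv u v : R := (u^T *m v) 0 0.

Definition covariance_mx Sigma : Prop :=
  Sigma \is symmetricmx /\ forall v, v != 0 -> 0 < dotv v (Sigma *m v).

Definition gaussian_density mu Sigma theta : R :=
  (Num.sqrt ((2 * pi) ^+ d * \det Sigma))^-1 *
  expR (- dotv (theta - mu) (invmx Sigma *m (theta - mu)) / 2).

Definition proportional f g : Prop :=
  exists2 c : R, 0 < c & forall theta, f theta = c * g theta.

Definition integral_Rd f : R :=
  (\int[lebesgue_tuple R d]_x f (\col_i tnth x i))%R.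

(** Division by the total mass normalizes [prior * lik] only when its integral
    is finite and nonzero; the integrals are real-valued, with junk value 0
    when infinite. *)
Definition posterior_density prior lik theta : R :=
  prior theta * lik theta / integral_Rd (fun t => prior t * lik t).

Definition density_mean p : 'cV[R]_d :=
  \col_i integral_Rd (fun theta => theta i 0 * p theta).

End GaussianBayes.

(** Discrepant posterior phenomenon: the posterior mean lies strictly on one
    side of both the prior mean and the maximum likelihood estimate. *)
Definition discrepant (R : realType) (eta_post eta_prior eta_lik : R) : Prop :=
  0 < (eta_post - eta_prior) * (eta_post - eta_lik).

(* Main.v *)
Require Import Defs.
From HB Require Import structures.
From mathcomp Require Import all_boot all_order all_algebra.
From mathcomp Require Import sesquilinear polyrcf ring lra.
From mathcomp Require Import all_classical all_reals all_analysis.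
From mathcomp Require Import measurable_realfun.

Set Implicit Arguments.
Unset Strict Implicit.
Unset Printing Implicit Defensive.

Import Order.TTheory GRing.Theory Num.Theory.
Import numFieldNormedType.Exports.

Local Open Scope classical_set_scope.
Local Open Scope ring_scope.

(** Up to a nonzero constant, [prior * lik] is the Gaussian kernel with precision
    [Sigma_pi^-1 + Sigma_L^-1] centered at the minimizer [m] of the sum of the
    two quadratic forms.  It is invariant under the measure-preserving
    reflection [theta |-> 2 m - theta], so once its first moments are known to
    be finite its mean is [m], and no normalizing constant has to be computed.
    Then [eta_p - eta_pi = Delta1] and [eta_p - eta_L = - Delta2], so the
    phenomenon occurs exactly when [Delta1 * Delta2 < 0]. *)

(** * Linear algebra of symmetric positive definite matrices *)

Section Covariance.
Context (R : realType) (d : nat).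
Implicit Types (u v w : 'cV[R]_d) (S T : 'M[R]_d).

Lemma dotvE u v : dotv u v = \sum_i u i 0 * v i 0.
Proof. by rewrite /dotv mxE; apply: eq_bigr => i _; rewrite mxE. Qed.

Lemma dotvC u v : dotv u v = dotv v u.
Proof. by rewrite !dotvE; apply: eq_bigr => i _; rewrite mulrC. Qed.

Lemma dotvDl u v w : dotv (u + v) w = dotv u w + dotv v w.
Proof. by rewrite /dotv linearD mulmxDl mxE. Qed.

Lemma dotvDr u v w : dotv u (v + w) = dotv u v + dotv u w.
Proof. by rewrite dotvC dotvDl !(dotvC u). Qed.

Lemma dotvZl (a : R) u v : dotv (a *: u) v = a * dotv u v.
Proof. by rewrite /dotv linearZ -scalemxAl mxE. Qed.

Lemma dotvZr (a : R) u v : dotv u (a *: v) = a * dotv u v.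
Proof. by rewrite dotvC dotvZl dotvC. Qed.

Lemma dotvNl u v : dotv (- u) v = - dotv u v.
Proof. by rewrite -scaleN1r dotvZl mulN1r. Qed.

Lemma dotvNr u v : dotv u (- v) = - dotv u v.
Proof. by rewrite dotvC dotvNl dotvC. Qed.

Lemma dotv_delta i u : dotv (delta_mx i 0) u = u i 0.
Proof.
rewrite dotvE (bigD1 i)//= mxE !eqxx mul1r big1 ?addr0// => j ji.
by rewrite mxE (negbTE ji) mul0r.
Qed.

(** [symmetricmx] is the hermitian predicate with sign exponent 0 and trivial conjugation, which is
    why [expr0] and [map_mx_id] turn it into equality with the transpose. *)
Lemma covariance_mx_tr S : covariance_mx S -> S^T = S.
Proof.
by case=> /is_hermitianmxP sS _; rewrite [RHS]sS expr0 scale1r map_mx_id.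
Qed.

Lemma covariance_mx_dotvC S u v :
  covariance_mx S -> dotv u (S *m v) = dotv v (S *m u).
Proof.
by move=> /covariance_mx_tr sS; rewrite dotvC /dotv trmx_mul sS mulmxA.
Qed.

Lemma covariance_mx_ge0 S v : covariance_mx S -> 0 <= dotv v (S *m v).
Proof.
move=> [_ pS]; have [->|v0] := eqVneq v 0; last exact/ltW/pS.
by rewrite mulmx0 dotvE big1// => i _; rewrite mxE mul0r.
Qed.

Lemma dotv_ge0 v : 0 <= dotv v v.
Proof. by rewrite dotvE sumr_ge0// => i _; rewrite -expr2 sqr_ge0. Qed.

(* The characteristic polynomial of [- S] takes the value [\det S] at 0, is
   positive near infinity, and has no root on the nonnegative half-line. *)
Lemma covariance_mx_det_gt0 S : covariance_mx S -> 0 < \det S.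
Proof.
move=> cS; rewrite ltNge; apply/negP => detS.
pose p := char_poly (- S).
have p0 : p.[0] = \det S.
  by rewrite horner_coef0 char_poly_det -(scaleN1r S) detZ mulrA -exprMn mulrNN
    mulr1 expr1n mul1r.
have lp : lead_coef p = 1 by exact/monicP/char_poly_monic.
have [n pn] : exists n, forall x, x >= n -> p.[x] >= lead_coef p.
  by apply: poly_pinfty_gt_lc; rewrite lp.
(* The threshold [n] may be negative, while the intermediate value theorem is applied on an interval
   starting at 0. *)
have b0 : 0 <= Num.max n 0 by rewrite le_max lexx orbT.
have pb : p.[0] <= 0 <= p.[Num.max n 0].
  by rewrite p0 detS (le_trans _ (pn _ _)) ?lp// le_max lexx.
have [c c0] := poly_ivt b0 pb.
(* A root [c >= 0] is an eigenvalue of [- S]; eigenvectors are rows here, so [v *m S = - c *: v]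
   gives the form at [v^T] the value [- c * |v|^2 <= 0], against positivity. *)
rewrite -eigenvalue_root_char => /eigenvalueP[v vS v0].
have vt0 : v^T != 0 by rewrite -(inj_eq trmx_inj) trmxK trmx0.
have := cS.2 _ vt0; rewrite /dotv mulmxA trmxK.
have -> : v *m S = - c *: v by rewrite scaleNr -vS mulmxN opprK.
rewrite -scalemxAl mxE mulNr oppr_gt0; apply/negP; rewrite -leNgt mulr_ge0//.
  by case/andP: c0.
by have := dotv_ge0 v^T; rewrite /dotv trmxK.
Qed.

Lemma covariance_mx_unit S : covariance_mx S -> S \in unitmx.
Proof. by move=> /covariance_mx_det_gt0; rewrite unitmxE unitfE lt0r => /andP[]. Qed.

(** Substituting [v = S w] with [w = S^-1 v] turns [v^T S^-1 v] into [w^T S w], and [w] is nonzero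
    when [v] is. *)
Lemma covariance_mx_inv S : covariance_mx S -> covariance_mx (invmx S).
Proof.
move=> cS; have uS := covariance_mx_unit cS; split.
  by apply/is_hermitianmxP; rewrite expr0 scale1r map_mx_id// trmx_inv
    covariance_mx_tr.
move=> v v0; rewrite -{1}(mulKVmx uS v) dotvC covariance_mx_dotvC//.
rewrite mulKVmx// dotvC -{1}(mulKVmx uS v).
rewrite dotvC; apply: cS.2; apply: contra_neq v0 => v0.
by rewrite -(mulKVmx uS v) v0 mulmx0.
Qed.

Lemma covariance_mxD S T :
  covariance_mx S -> covariance_mx T -> covariance_mx (S + T).
Proof.
move=> cS cT; split.
  by apply/is_hermitianmxP; rewrite expr0 scale1r map_mx_id// linearD/=
    !covariance_mx_tr.
by move=> v v0; rewrite mulmxDl dotvDr addr_gt0// ?cS.2 ?cT.2.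
Qed.

(* Cauchy-Schwarz for the form of [invmx S], applied to [u] and [S e_i]. *)
Lemma sqr_coord_le S u i : covariance_mx S ->
  u i 0 ^+ 2 <= S i i * dotv u (invmx S *m u).
Proof.
move=> cS; have uS := covariance_mx_unit cS.
pose e : 'cV[R]_d := delta_mx i 0.
have eS : dotv e (S *m e) = S i i.
  by rewrite dotv_delta -colE mxE.
have Sii : 0 < S i i.
  rewrite -eS; apply: cS.2; apply/eqP => /matrixP/(_ i 0).
  by rewrite !mxE !eqxx => /eqP; rewrite oner_eq0.
(* This [t] minimizes the quadratic polynomial [q + 2 t u_i + t^2 S_ii]; its minimum
   [q - u_i^2 / S_ii] is therefore nonnegative. *)
set q := dotv u _; pose t := - (u i 0 / S i i).
have : 0 <= dotv (u + t *: (S *m e)) (invmx S *m (u + t *: (S *m e))).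
  exact/covariance_mx_ge0/covariance_mx_inv.
rewrite mulmxDr -scalemxAr mulKmx// !(dotvDl, dotvDr, dotvZl, dotvZr) -/q.
rewrite (covariance_mx_dotvC _ _ (covariance_mx_inv cS)) mulKmx//.
rewrite (dotvC (S *m e)) (dotvC u) eS dotv_delta.
rewrite (_ : _ + _ = q - u i 0 ^+ 2 / S i i); last first.
  by rewrite /t; field; rewrite gt_eqF.
by rewrite subr_ge0 ler_pdivrMr// mulrC.
Qed.

(* [m] is the minimizer of the sum of the two quadratic forms. *)
Lemma complete_square S T (a b x : 'cV[R]_d) :
  covariance_mx S -> covariance_mx T ->
  let m := invmx (S + T) *m (S *m a + T *m b) in
  dotv (x - a) (S *m (x - a)) + dotv (x - b) (T *m (x - b)) =
  dotv (x - m) ((S + T) *m (x - m)) +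
  (dotv (m - a) (S *m (m - a)) + dotv (m - b) (T *m (m - b))).
Proof.
move=> cS cT m.
(* The gradient of the sum of the two forms vanishes at [m]; this makes the cross terms in [x - m]
   cancel below. *)
have mE : S *m (m - a) = - (T *m (m - b)).
  apply/eqP; rewrite -addr_eq0 !mulmxBr addrACA -opprD -mulmxDl mulKVmx ?subrr//.
  exact/covariance_mx_unit/covariance_mxD.
rewrite -(subrKA m x (- a)) -(subrKA m x (- b)).
move: (x - m) (m - a) (m - b) mE => y p q pq.
rewrite !(mulmxDr, mulmxDl S) !(dotvDl, dotvDr).
rewrite (covariance_mx_dotvC p y cS) (covariance_mx_dotvC q y cT) pq !dotvNr.
ring.
Qed.

End Covariance.

(** * Tonelli, reflections and product integrands for the iterated Lebesgue measure *)

Section LebesgueTupleIntegral.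
Context (R : realType).
Local Open Scope ereal_scope.

Lemma ge0_integral_lebesgue_tupleS n (f : n.+1.-tuple R -> \bar R) :
  measurable_fun setT f -> (forall t, 0 <= f t) ->
  \int[lebesgue_tuple R n.+1]_t f t =
  \int[lebesgue_measure]_x \int[lebesgue_tuple R n]_t f (cons_pair (x, t)).
Proof.
move=> mf f0.
have mc :
    measurable_fun [set: measurableTypeR R * n.-tuple R] (@cons_pair R n).
  exact: measurable_cons_pair.
transitivity (\int[(lebesgue_measure \x lebesgue_tuple R n)]_p f (cons_pair p)).
  have h := @ge0_integral_pushforward _ _ _ _ _ _ mc
    (lebesgue_measure \x lebesgue_tuple R n) setT f.
  by rewrite -h.
by rewrite fubini_tonelli1//; exact: measurableT_comp.
Qed.

(** By uniqueness of Lebesgue measure it suffices to treat intervals []a, b]], whose preimage [[c -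
    b, c - a[] has the same length. *)
Lemma lebesgue_measure_reflect (c : R) (A : set (measurableTypeR R)) :
  measurable A ->
  pushforward lebesgue_measure
    ((fun x : R => (c - x)%R) : measurableTypeR R -> measurableTypeR R) A =
  lebesgue_measure A.
Proof.
move=> mA; apply/esym/lebesgue_measure_unique => //=.
  exact: measurable_funB.
move=> _ _ [[a b]] _ <-.
rewrite /pushforward.
rewrite (_ : _ @^-1` _ = `[(c - b)%R, (c - a)%R[%classic); last first.
  apply/seteqP; split => x; rewrite /= !in_itv/= => /andP[? ?];
    apply/andP; split; lra.
rewrite !lebesgue_measure_itv/= !lte_fin ltrD2l ltrN2.
by case: ifP => // _; rewrite -!EFinD; congr EFin; ring.
Qed.

Lemma ge0_integral_lebesgue_reflect (c : R) (f : R -> \bar R) :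
  measurable_fun setT f -> (forall x, 0 <= f x) ->
  \int[lebesgue_measure]_x f (c - x)%R = \int[lebesgue_measure]_x f x.
Proof.
move=> mf f0.
have mc : measurable_fun setT
    ((fun x : R => (c - x)%R) : measurableTypeR R -> measurableTypeR R).
  exact: measurable_funB.
have h := @ge0_integral_pushforward _ _ _ _ _ _ mc lebesgue_measure setT f.
rewrite -h//.
by apply: eq_measure_integral => //= A mA _; exact: lebesgue_measure_reflect.
Qed.

(** Point reflection through [c / 2], built coordinatewise so that it respects the recursive
    construction of [lebesgue_tuple]. *)
Definition reflect_tuple n (c : 'I_n -> R) (t : n.-tuple R) : n.-tuple R :=
  [tuple (c i - tnth t i)%R | i < n].

Lemma measurable_reflect_tuple n (c : 'I_n -> R) :
  measurable_fun setT (reflect_tuple c).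
Proof.
apply/measurable_fun_tnthP => i; rewrite /comp.
under eq_fun do rewrite tnth_mktuple.
by apply: measurable_funB => //; exact: measurable_tnth.
Qed.

Lemma reflect_tuple_cons n (c : 'I_n.+1 -> R) (x : R) (t : n.-tuple R) :
  reflect_tuple c (cons_pair (x, t)) =
  cons_pair ((c ord0 - x)%R, reflect_tuple (fun i => c (lift ord0 i)) t).
Proof.
apply: eq_from_tnth => i; rewrite tnth_mktuple /cons_pair/=.
by case: (unliftP ord0 i) => [j|] ->; rewrite ?tnth0// !tnthS tnth_mktuple.
Qed.

(** Induction on the dimension: Tonelli splits off the first coordinate, the one-dimensional
    reflection handles the outer integral and the induction hypothesis the inner one. *)
Lemma ge0_integral_reflect_tuple n (c : 'I_n -> R) (f : n.-tuple R -> \bar R) :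
  measurable_fun setT f -> (forall t, 0 <= f t) ->
  \int[lebesgue_tuple R n]_t f (reflect_tuple c t) =
  \int[lebesgue_tuple R n]_t f t.
Proof.
elim: n => [|n IH] in c f * => mf f0.
  by apply: eq_integral => t _; congr f; apply: eq_from_tnth => -[].
have mr := measurable_reflect_tuple c.
rewrite !ge0_integral_lebesgue_tupleS//; last exact: measurableT_comp.
pose g x := \int[lebesgue_tuple R n]_t f (cons_pair (x, t)).
have mcons : measurable_fun setT (fun p => f (@cons_pair R n p)).
  by apply: measurableT_comp => //; exact: measurable_cons_pair.
have mg : measurable_fun setT g.
  exact: (@measurable_fun_fubini_tonelli_F _ _ _ _ _ (lebesgue_tuple R n) _
    mcons).
rewrite -[RHS](ge0_integral_lebesgue_reflect (c ord0) mg); last first.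
  by move=> x; exact: integral_ge0.
apply: eq_integral => x _; rewrite /g.
under eq_integral do rewrite reflect_tuple_cons.
rewrite (IH _ (fun t => f (cons_pair ((c ord0 - x)%R, t))))//.
exact: measurableT_comp mcons (measurable_pair1 _).
Qed.

(** Taking positive and negative parts commutes with precomposition by the reflection, so the
    nonnegative case applies to each part. *)
Lemma integral_reflect_tuple n (c : 'I_n -> R) (f : n.-tuple R -> \bar R) :
  measurable_fun setT f ->
  \int[lebesgue_tuple R n]_t f (reflect_tuple c t) =
  \int[lebesgue_tuple R n]_t f t.
Proof.
move=> mf; rewrite integralE [RHS]integralE.
rewrite (eq_integral (fun t => f^\+ (reflect_tuple c t))); last first.
  by move=> t _; rewrite !funeposE.
rewrite [X in _ - X](eq_integral (fun t => f^\- (reflect_tuple c t))); last first.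
  by move=> t _; rewrite !funenegE.
rewrite (ge0_integral_reflect_tuple c (f := f^\+))//; last first.
  exact: measurable_funepos.
rewrite (ge0_integral_reflect_tuple c (f := f^\-))//.
exact: measurable_funeneg.
Qed.

Lemma integral_lebesgue_tuple_prod n (h : 'I_n -> R -> R) :
  (forall i, measurable_fun setT (h i)) -> (forall i x, (0 <= h i x)%R) ->
  \int[lebesgue_tuple R n]_t (\prod_(i < n) h i (tnth t i))%:E =
  \prod_(i < n) \int[lebesgue_measure]_x (h i x)%:E.
Proof.
elim: n => [|n IH] in h * => mh h0.
  under eq_integral do rewrite big_ord0.
  by rewrite big_ord0 integral_cst//= diracT mul1e.
have mprod m (k : 'I_m -> R -> R) : (forall i, measurable_fun setT (k i)) ->
    measurable_fun setT (fun t : m.-tuple R =>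
      (\prod_(i < m) k i (tnth t i))%:E).
  move=> mk; apply/measurable_EFinP/measurable_prod => i _.
  by apply: measurableT_comp => //; exact: measurable_tnth.
rewrite ge0_integral_lebesgue_tupleS//; last 2 first.
  exact: mprod.
  by move=> t; rewrite lee_fin prodr_ge0.
rewrite big_ord_recl -IH//.
rewrite -ge0_integralZr//.
- apply: eq_integral => x _.
  rewrite (eq_integral (fun t : n.-tuple R => (h ord0 x)%:E *
      (\prod_(i < n) h (lift ord0 i) (tnth t i))%:E)); last first.
    move=> t _; rewrite big_ord_recl /cons_pair tnth0 EFinM.
    by under eq_bigr do rewrite tnthS.
  rewrite ge0_integralZl//.
  + by apply: (mprod _ (fun i => h (lift ord0 i))).
  + by move=> t _; rewrite lee_fin prodr_ge0.
  + by rewrite lee_fin.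
- by apply/measurable_EFinP; exact: mh.
- by move=> x _; rewrite lee_fin.
- by apply: integral_ge0 => t _; rewrite lee_fin prodr_ge0.
Qed.

End LebesgueTupleIntegral.

(** * First moments of symmetric functions, and integrability by Gaussian domination *)

Section Moments.
Context (R : realType) (d : nat).
Implicit Types (m theta : 'cV[R]_d) (f : 'cV[R]_d -> R) (S : 'M[R]_d).

(** The sigma-algebra and the measure live on tuples, so functions of column vectors are read
    through the same identification as in [integral_Rd]. *)
Definition measurable_Rd f : Prop :=
  measurable_fun [set: d.-tuple R] (fun x => f (\col_i tnth x i)).

Definition integrable_Rd f : Prop :=
  (lebesgue_tuple R d).-integrable setT
    (fun x => (f (\col_i tnth x i))%:E).

Lemma measurable_Rd_coord i : measurable_Rd (fun theta => theta i 0).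
Proof.
rewrite /measurable_Rd; under eq_fun do rewrite mxE.
exact: measurable_tnth.
Qed.

Lemma measurable_RdM f g :
  measurable_Rd f -> measurable_Rd g -> measurable_Rd (fun t => f t * g t).
Proof. by move=> mf mg; exact: measurable_funM. Qed.

Lemma measurable_Rd_quadratic m S :
  measurable_Rd (fun theta => dotv (theta - m) (S *m (theta - m))).
Proof.
have mB j : measurable_Rd (fun theta => (theta - m) j 0).
  rewrite /measurable_Rd; under eq_fun do rewrite !mxE.
  by apply: measurable_funB => //; exact: measurable_tnth.
rewrite /measurable_Rd; under eq_fun do rewrite dotvE.
apply: measurable_sum => j; apply: measurable_funM; first exact: mB.
under eq_fun do rewrite mxE.
by apply: measurable_sum => k; apply: measurable_funM => //; exact: mB.
Qed.

Lemma integral_Rd_reflect m f : measurable_Rd f ->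
  integral_Rd (fun theta => f (m *+ 2 - theta)) = integral_Rd f.
Proof.
move=> mf; congr fine.
have /= <- := integral_reflect_tuple (fun i => (m *+ 2) i 0)
  (f := fun x => (f (\col_i tnth x i))%:E) ((measurable_EFinP _ _).2 mf).
apply: eq_integral => x _; congr (f _)%:E.
by apply/colP => i; rewrite !mxE tnth_mktuple !mxE.
Qed.

(** Reflecting the moment [J] replaces [theta_i] by [2 m_i - theta_i] and leaves [f] alone, so
    [J = 2 m_i * integral_Rd f - J]. Integrability justifies splitting the integral. *)
Lemma integral_Rd_moment_symmetric m f i :
  (forall theta, f (m *+ 2 - theta) = f theta) ->
  integrable_Rd f -> integrable_Rd (fun theta => theta i 0 * f theta) ->
  integral_Rd (fun theta => theta i 0 * f theta) = m i 0 * integral_Rd f.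
Proof.
move=> fS intf intif.
have mif : measurable_Rd (fun theta => theta i 0 * f theta).
  by apply/measurable_EFinP; case/integrableP: intif.
set J := LHS.
suff : J = m i 0 * integral_Rd f *+ 2 - J by move=> JE; lra.
rewrite {1}/J -(integral_Rd_reflect m mif) -mulrnAl.
rewrite /J /integral_Rd -RintegralZl// -RintegralB//.
- apply: eq_Rintegral => x _; rewrite fS !mxE.
  ring.
- by apply: eq_integrable (integrableZl measurableT ((m i 0) *+ 2) intf).
Qed.

(** The dominating function is integrable because its integral factors into one-dimensional normal
    integrals, each equal to 1. *)
Lemma integrable_Rd_normal_bound m (s C : R) f : measurable_Rd f ->
  (forall theta,
    `|f theta| <= C * \prod_(j < d) normal_pdf (m j 0) s (theta j 0)) ->
  integrable_Rd f.
Proof.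
move=> mf fle.
apply: (@le_integrable _ _ R (lebesgue_tuple R d) setT measurableT _
  (fun x : d.-tuple R => (C * \prod_(j < d) normal_pdf (m j 0) s (tnth x j))%:E)) => //.
- exact/measurable_EFinP.
- move=> x _; rewrite !abse_EFin lee_fin (le_trans (fle _))//.
  by rewrite (le_trans _ (ler_norm _))//; under eq_bigr do rewrite mxE.
under eq_fun do rewrite EFinM.
apply: integrableZl => //; apply/integrableP; split.
  apply/measurable_EFinP/measurable_prod => i _.
  apply: measurableT_comp; first exact: measurable_normal_pdf.
  exact: measurable_tnth.
rewrite (eq_integral (fun x : d.-tuple R =>
    (\prod_(j < d) normal_pdf (m j 0) s (tnth x j))%:E)); last first.
  move=> x _; rewrite gee0_abs// lee_fin prodr_ge0// => i _.
  exact: normal_pdf_ge0.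
rewrite (integral_lebesgue_tuple_prod
  (h := fun j x => normal_pdf (m j 0) s x)).
- by rewrite big1 ?ltry// => i _; exact: integral_normal_pdf.
- by move=> i; exact: measurable_normal_pdf.
- by move=> i x; exact: normal_pdf_ge0.
Qed.

(** If the integral were 0, [f] would vanish almost everywhere; being positive everywhere, it would
    force the whole space to be null, yet the whole space is a box with sides of positive
    measure. *)
Lemma integral_Rd_gt0 f : integrable_Rd f -> (forall theta, 0 < f theta) ->
  0 < integral_Rd f.
Proof.
move=> intf f0.
rewrite lt_neqAle Rintegral_ge0 ?andbT; last by move=> x _; exact/ltW.
apply/eqP => /esym f00.
have mT : lebesgue_tuple R d setT = 0%E.
  have : ae_eq (lebesgue_tuple R d) setT
      (fun x => (f (\col_i tnth x i))%:E) (cst 0%E).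
    apply/ae_eq_integral_abs => //; first by case/integrableP: intf.
    under eq_integral do rewrite gee0_abs ?lee_fin ?ltW//.
    (* Integrability excludes an infinite integral, which [fine] would also send to 0. *)
    by rewrite -[LHS]fineK ?[X in X%:E]f00//; exact: integrable_fin_num.
  move=> [N [mN N0 sN]]; apply: (subset_measure0 _ mN _ N0) => // x _.
  by apply: sN => /= /(_ I) [] /eqP; rewrite gt_eqF.
have : (0 < lebesgue_tuple R d [set t | forall i, setT (tnth t i)])%E.
  rewrite (@lebesgue_tuple_box R d (fun _ => setT))//.
  apply: (big_ind (fun x : \bar R => 0 < x)%E) => //; first exact: mule_gt0.
  by move=> i _; rewrite -set_itvNyy lebesgue_measure_itv/= ltry.
by rewrite (_ : [set t | _] = setT) ?mT ?ltxx//; apply/seteqP.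
Qed.

End Moments.

(** * The mean of a normalized Gaussian kernel *)

Section GaussianMean.
Context (R : realType) (d : nat).
Implicit Types (m u theta : 'cV[R]_d) (f : 'cV[R]_d -> R) (S : 'M[R]_d).

Definition gaussian_kernel m S theta : R :=
  expR (- dotv (theta - m) (invmx S *m (theta - m)) / 2).

(* [1 + |u_i|] is absorbed by half of the exponent, and the other half is
   bounded below coordinatewise since [|u|^2 <= \tr S * (u^T S^-1 u)]. *)
Lemma gaussian_kernel_le_normal m S i : covariance_mx S ->
  exists s C : R, forall theta,
    (1 + `|theta i 0|) * gaussian_kernel m S theta <=
    C * \prod_(j < d) normal_pdf (m j 0) s (theta j 0).
Proof.
move=> cS; have cV := covariance_mx_inv cS.
have S0 j : 0 <= S j j.
  have := covariance_mx_ge0 (delta_mx j 0) cS.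
  by rewrite dotv_delta -colE mxE.
(* [tau] is positive and bounds both the trace and every diagonal entry of [S]. Taking [s^2 = 2 tau]
   gives the normal density the exponent [- u_j^2 / (4 tau)]. *)
pose tau := 1 + \tr S.
have tau0 : 0 < tau by rewrite ltr_pwDl// sumr_ge0.
have Sle j : S j j <= tau.
  by rewrite /tau /mxtrace (bigD1 j)//= addrCA lerDl addr_ge0// sumr_ge0.
pose s := Num.sqrt (tau *+ 2).
have s2 : s ^+ 2 *+ 2 = 4 * tau.
  by rewrite sqr_sqrtr ?mulrn_wge0 ?(ltW tau0)//; ring.
have s0 : s != 0 by rewrite gt_eqF// sqrtr_gt0 pmulrn_lgt0.
(* [D] is the product of the constants in [thetai] and [ui] below; the power of [normal_peak s] in
   the witness cancels the peaks of the [d] normal densities. *)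
pose D : R := (1 + `|m i 0|) * (2 + 4 * tau).
have D0 : 0 <= D by rewrite mulr_ge0 ?addr_ge0 ?mulr_ge0// ltW.
exists s, (D * (normal_peak s)^-1 ^+ d) => theta.
rewrite /gaussian_kernel; set u := theta - m; set Q := dotv u _.
have uE j : u j 0 = theta j 0 - m j 0 by rewrite !mxE.
have Q0 : 0 <= Q by exact: covariance_mx_ge0.
have prodE : (normal_peak s)^-1 ^+ d *
    \prod_(j < d) normal_pdf (m j 0) s (theta j 0) =
    expR (- (\sum_j u j 0 ^+ 2) / (4 * tau)).
  rewrite -[X in _ ^+ X](card_ord d) -prodr_const -big_split/=.
  rewrite mulNr mulr_suml -sumrN expR_sum; apply: eq_bigr => j _.
  rewrite normal_pdfE// mulKf ?gt_eqF ?normal_peak_gt0// /normal_fun s2 uE.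
  by rewrite mulNr.
rewrite -mulrA prodE.
have uQ : \sum_j u j 0 ^+ 2 <= tau * Q.
  rewrite (le_trans (ler_sum _ (fun j _ => sqr_coord_le u j cS)))//.
  by rewrite -mulr_suml ler_wpM2r// lerDr.
have uiQ : u i 0 ^+ 2 <= tau * Q.
  by rewrite (le_trans (sqr_coord_le u i cS))// ler_wpM2r.
have thetai : 1 + `|theta i 0| <= (1 + `|m i 0|) * (1 + `|u i 0|).
  have : `|theta i 0| <= `|m i 0| + `|u i 0|.
    by rewrite uE (le_trans _ (ler_normD _ _))// addrC subrK.
  have : 0 <= `|m i 0| * `|u i 0| by rewrite mulr_ge0.
  nra.
have ui : 1 + `|u i 0| <= (2 + 4 * tau) * expR (Q / 4).
  have eQ : 1 + Q / 4 <= expR (Q / 4) by exact: expR_ge1Dx.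
  have : `|u i 0| <= 1 + u i 0 ^+ 2.
    rewrite -(real_normK (num_real _)); have : 0 <= `|u i 0| by [].
    nra.
  move=> ?; apply: (@le_trans _ _ ((2 + 4 * tau) * (1 + Q / 4))); last first.
    by rewrite ler_pM2l// addr_gt0// mulr_gt0.
  nra.
(* What remains is [expR (- Q / 4)], and [|u|^2 <= tau * Q] bounds it by
   [expR (- |u|^2 / (4 tau))]. *)
apply: (@le_trans _ _ (D * expR (Q / 4) * expR (- Q / 2))).
  rewrite ler_pM2r ?expR_gt0// (le_trans thetai)// /D -mulrA.
  by rewrite ler_pM2l// ltr_pwDl.
rewrite -mulrA ler_wpM2l// -expRD ler_expR.
have : \sum_j u j 0 ^+ 2 / (4 * tau) <= Q / 4.
  rewrite -mulr_suml ler_pdivrMr ?mulr_gt0// (le_trans uQ)//.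
  by rewrite le_eqVlt; apply/orP; left; apply/eqP; field.
rewrite -mulr_suml; lra.
Qed.

Lemma measurable_gaussian_kernel m S : measurable_Rd (gaussian_kernel m S).
Proof.
rewrite /measurable_Rd /gaussian_kernel.
apply: measurableT_comp => //; apply: measurable_funM => //.
by apply: measurableT_comp => //; exact: measurable_Rd_quadratic.
Qed.

Lemma gaussian_kernel_reflect m S theta :
  gaussian_kernel m S (m *+ 2 - theta) = gaussian_kernel m S theta.
Proof.
rewrite /gaussian_kernel (_ : m *+ 2 - theta - m = - (theta - m)); last first.
  by rewrite mulr2n addrAC addrK opprB.
by rewrite mulmxN dotvNl dotvNr opprK.
Qed.

Lemma integrable_Rd_gaussian_kernel m S (i : 'I_d) : covariance_mx S ->
  integrable_Rd (gaussian_kernel m S) /\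
  integrable_Rd (fun theta => theta i 0 * gaussian_kernel m S theta).
Proof.
move=> cS; have [s [C le]] := gaussian_kernel_le_normal m i cS.
have mg := measurable_gaussian_kernel m S.
split; apply: (integrable_Rd_normal_bound (m := m) (s := s) (C := C)).
- exact: mg.
- move=> theta; rewrite ger0_norm ?expR_ge0// (le_trans _ (le theta))//.
  by rewrite ler_peMl ?expR_ge0// lerDl.
- by apply: measurable_RdM => //; exact: measurable_Rd_coord.
- move=> theta; rewrite normrM (ger0_norm (expR_ge0 _)).
  by rewrite (le_trans _ (le theta))// ler_wpM2r ?expR_ge0// lerDr.
Qed.

(** The factor [k] cancels between [f] and its integral, and the symmetry of the kernel about [m]
    yields coordinate [i] of the mean as [G^-1 * (m_i * G)], where [G > 0] is the kernel's mass. *)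
Lemma density_mean_gaussian_kernel m S (k : R) f : covariance_mx S -> k != 0 ->
  (forall theta, f theta = k * gaussian_kernel m S theta) ->
  density_mean (fun theta => f theta / integral_Rd f) = m.
Proof.
move=> cS k0 fE; apply/colP => i; rewrite mxE.
have [intg intig] := integrable_Rd_gaussian_kernel m i cS.
have g0 : 0 < integral_Rd (gaussian_kernel m S).
  by apply: integral_Rd_gt0 => // theta; exact: expR_gt0.
have -> : integral_Rd f = k * integral_Rd (gaussian_kernel m S).
  by rewrite /integral_Rd -RintegralZl//; under eq_Rintegral do rewrite fE.
set G := integral_Rd _ in g0 *.
transitivity (integral_Rd (fun theta =>
    G^-1 * (theta i 0 * gaussian_kernel m S theta))).
  apply: eq_Rintegral => x _; rewrite fE.
  by field; rewrite k0 gt_eqF.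
rewrite /integral_Rd RintegralZl//.
rewrite [X in _ * X](integral_Rd_moment_symmetric
  (gaussian_kernel_reflect m S))//.
by rewrite -/G; field; rewrite gt_eqF.
Qed.

End GaussianMean.

(** * The posterior mean and the sign criterion *)

Lemma gaussian_product_kernel (R : realType) (d : nat)
    (mu_pi mu_L : 'cV[R]_d) (Sigma_pi Sigma_L : 'M[R]_d)
    (prior lik : 'cV[R]_d -> R) :
  covariance_mx Sigma_pi -> covariance_mx Sigma_L ->
  (forall theta, prior theta = gaussian_density mu_pi Sigma_pi theta) ->
  proportional lik (gaussian_density mu_L Sigma_L) ->
  let Sigma_p := invmx (invmx Sigma_pi + invmx Sigma_L) in
  let mu_p := Sigma_p *m (invmx Sigma_pi *m mu_pi + invmx Sigma_L *m mu_L) in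
  exists2 k : R, k != 0 & forall theta,
    prior theta * lik theta = k * gaussian_kernel mu_p Sigma_p theta.
Proof.
move=> cpi cL priorE [c c0 likE] Sigma_p mu_p.
have norm_neq0 (S : 'M[R]_d) : covariance_mx S ->
    (Num.sqrt ((2 * pi) ^+ d * \det S))^-1 != 0 :> R.
  move=> cS; rewrite invr_eq0 gt_eqF// sqrtr_gt0 mulr_gt0//.
    by rewrite exprn_gt0// mulr_gt0// pi_gt0.
  exact: covariance_mx_det_gt0.
(* [q] is the minimum of the sum of the two quadratic forms, the part independent of [theta] left by
   completing the square. It enters [k] together with both normalizing constants and the factor
   [c]. *)
pose q := dotv (mu_p - mu_pi) (invmx Sigma_pi *m (mu_p - mu_pi)) +
  dotv (mu_p - mu_L) (invmx Sigma_L *m (mu_p - mu_L)).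
exists ((Num.sqrt ((2 * pi) ^+ d * \det Sigma_pi))^-1 *
  (c * (Num.sqrt ((2 * pi) ^+ d * \det Sigma_L))^-1) * expR (- q / 2)).
  by rewrite !mulf_neq0 ?norm_neq0 ?gt_eqF ?expR_gt0.
move=> theta; rewrite priorE likE /gaussian_density /gaussian_kernel.
set a := (Num.sqrt (_ * \det Sigma_pi))^-1.
set b := (Num.sqrt (_ * \det Sigma_L))^-1.
have := complete_square mu_pi mu_L theta (covariance_mx_inv cpi)
  (covariance_mx_inv cL).
rewrite /= -/Sigma_p -/mu_p -/q [invmx Sigma_p]invmxK; set Qp := dotv (theta - mu_p) _.
set Qpi := dotv (theta - mu_pi) _; set QL := dotv (theta - mu_L) _ => QE.
transitivity (a * (c * b) * expR (- Qpi / 2 + - QL / 2)).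
  by rewrite expRD; ring.
rewrite -[RHS]mulrA -expRD; congr (_ * expR _).
lra.
Qed.

Theorem theorem3p2 (R : realType) (d : nat)
    (mu_pi mu_L lambda : 'cV[R]_d) (Sigma_pi Sigma_L : 'M[R]_d)
    (prior lik : 'cV[R]_d -> R) :
  (1 < d)%N ->
  covariance_mx Sigma_pi ->
  covariance_mx Sigma_L ->
  (forall theta, prior theta = gaussian_density mu_pi Sigma_pi theta) ->
  proportional lik (gaussian_density mu_L Sigma_L) ->
  let mu_p := density_mean (posterior_density prior lik) in
  let eta_p := dotv lambda mu_p in
  let eta_pi := dotv lambda mu_pi in
  let eta_L := dotv lambda mu_L in
  let Sigma_p := invmx (invmx Sigma_pi + invmx Sigma_L) in
  let Delta1 := dotv lambda (Sigma_p *m invmx Sigma_L *m (mu_L - mu_pi)) in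
  let Delta2 := dotv lambda (Sigma_p *m invmx Sigma_pi *m (mu_L - mu_pi)) in
  ~ discrepant eta_p eta_pi eta_L <->
  ((0 <= Delta1 /\ 0 <= Delta2) \/ (Delta1 <= 0 /\ Delta2 <= 0)).
Proof.
move=> _ cpi cL priorE likE mu_p eta_p eta_pi eta_L Sigma_p Delta1 Delta2.
have [k k0 prodE] := gaussian_product_kernel cpi cL priorE likE.
have cp : covariance_mx (invmx Sigma_pi + invmx Sigma_L).
  by apply: covariance_mxD; exact: covariance_mx_inv.
have mu_pE : mu_p =
    Sigma_p *m (invmx Sigma_pi *m mu_pi + invmx Sigma_L *m mu_L).
  exact: (density_mean_gaussian_kernel (covariance_mx_inv cp) k0 prodE).
(* Writing a prior or likelihood mean as [Sigma_p] applied to the total precision times it lets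
   [Sigma_p] be factored out of its difference with [mu_p]; one of the two precision terms then
   cancels. *)
have SpK (v : 'cV[R]_d) : v = Sigma_p *m ((invmx Sigma_pi + invmx Sigma_L) *m v).
  by rewrite mulKmx//; exact: covariance_mx_unit.
have D1 : eta_p - eta_pi = Delta1.
  rewrite -dotvNr -dotvDr; congr dotv; rewrite mu_pE {2}(SpK mu_pi).
  rewrite -mulmxBr -mulmxA; congr (_ *m _).
  by rewrite mulmxBr mulmxDl opprD addrACA subrr add0r.
have D2 : eta_p - eta_L = - Delta2.
  rewrite -dotvNr -dotvDr -dotvNr; congr dotv; rewrite mu_pE {2}(SpK mu_L).
  rewrite -mulmxBr -mulmxA -[RHS]mulmxN; congr (_ *m _).
  by rewrite mulmxBr opprB mulmxDl opprD addrACA subrr addr0.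
rewrite /discrepant D1 D2 mulrN oppr_gt0.
split => [/negP|[[D10 D20]|[D10 D20]]]; last 2 first.
- by apply/negP; rewrite -leNgt mulr_ge0.
- by apply/negP; rewrite -leNgt mulr_le0.
rewrite -leNgt => D12; have [D10|D10] := leP 0 Delta1.
(* When [Delta1 = 0] the product carries no information on [Delta2], but [Delta1] fits both
   alternatives and the sign of [Delta2] selects one. *)
- have [->|D1n0] := eqVneq Delta1 0; last first.
    have D1gt0 : 0 < Delta1 by rewrite lt_neqAle eq_sym D1n0.
    by left; split => //; rewrite -(pmulr_rge0 _ D1gt0).
  by have [|/ltW] := leP 0 Delta2; [left|right].
- by right; split; [exact: ltW|rewrite -(nmulr_rge0 _ D10)].
Qed.
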